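(* Let $\mathcal{H}_1,\mathcal{H}$ be real Hilbert spaces, let $H:\mathcal{H}_1\rightrightarrows\mathcal{H}_1$ be an arbitrary set-valued operator, let $M:\mathcal{H}_1\to\mathcal{H}$ be (bounded) linear and let $d\in\mathcal{H}$. Let $\gamma>0$ and let $D_H=(-M\circ H^{-1}\circ -M^* )(\cdot)-d$. Then $$J_{\gamma D_H}(u)=u+\gamma d+\gamma M\,J^M_{\gamma^{-1}H}\big(-M^*(\gamma^{-1}u+d)\big)\qquad\forall u\in\mathcal{H},$$ as an equality of (possibly empty) subsets of $\mathcal{H}$; the identity holds even when the operators $J_{\gamma D_H}$ and $J^M_{\gamma^{-1}H}$ do not have full domain, i.e. may have empty images. Furthermore, if $u\in\mathcal{H}$ and $\lambda\in J_{\gamma D_H}(u)$, then there exist $p\in\mathcal{H}$ and $q\in\mathcal{H}_1$ such that: (i) $p\in D_H(\lambda)$ and $u=\gamma p+\lambda$; (ii) $q\in H^{-1}(-M^*\lambda)$ and $p=-Mq-d$; (iii) $q\in J^M_{\gamma^{-1}H}\big(-M^*(\gamma^{-1}u+d)\big)$.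
   Context: $I$ is the identity map and $M^*:\mathcal{H}\to\mathcal{H}_1$ is the adjoint of $M$. For a set-valued operator $T$, $T^{-1}$ is the set-valued inverse: $x\in T^{-1}y\iff y\in Tx$. The dual operator $D_H:\mathcal{H}\rightrightarrows\mathcal{H}$ of $H$ with respect to $M$ and $d$ is $D_H(\lambda)=\{-Mx-d : x\in H^{-1}(-M^*\lambda)\}$. The resolvent of a set-valued operator $T$ is $J_T:=(I+T)^{-1}$ (possibly set-valued and possibly empty-valued). For $U:\mathcal{H}_1\to\mathcal{H}$ linear and $T:\mathcal{H}_1\rightrightarrows\mathcal{H}_1$, the generalized resolvent is $J^U_T:=(U^*U+T)^{-1}:\mathcal{H}_1\rightrightarrows\mathcal{H}_1$. For a set $S$ and vectors $a$, expressions such as $a+\gamma M S$ denote $\{a+\gamma M s: s\in S\}$ (empty if $S$ is empty). *)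

(* Defs.v *)
From HB Require Import structures.
From mathcomp Require Import all_boot all_order all_algebra.
From mathcomp Require Import boolp classical_sets reals topology normedtype.

Set Implicit Arguments.
Unset Strict Implicit.
Unset Printing Implicit Defensive.

Import Order.TTheory GRing.Theory Num.Theory.
Import numFieldNormedType.Exports.

Local Open Scope classical_set_scope.
Local Open Scope ring_scope.

(* Completeness comes from [CompleteNormedModule]; [inner_norm] says that the
   norm is the one induced by the inner product, which also makes the inner
   product positive definite. *)
HB.mixin Record NormedModule_isHilbert (R : realType) V
    of CompleteNormedModule R V := {
  inner : V -> V -> R ;
  innerC : forall x y : V, inner x y = inner y x ;
  innerDl : forall x y z : V, inner (x + y) z = inner x z + inner y z ;
  innerZl : forall (a : R) (x y : V), inner (a *: x) y = a * inner x y ;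
  inner_norm : forall x : V, inner x x = `|x| ^+ 2
}.

#[short(type="hilbertType")]
HB.structure Definition Hilbert (R : realType) :=
  {V of NormedModule_isHilbert R V & CompleteNormedModule R V}.

(* For bounded linear [M], the vector [z] exists by the Riesz representation
   theorem and is unique; the default value 0 only matters for other [M]. *)
Definition adjoint (R : realType) (V W : hilbertType R) (M : V -> W) : W -> V :=
  fun y => xget 0 [set z | forall x, inner (M x) y = inner x z].

(* A set-valued operator from V to W is a function [T : V -> set W];
   [T x y] reads "y is in T x". *)
Definition op_inv (V W : Type) (T : V -> set W) : W -> set V :=
  fun y => [set x | T x y].

Definition op_scale (R : realType) (V W : hilbertType R) (c : R)
    (T : V -> set W) : V -> set W :=
  fun x => [set c *: y | y in T x].

Definition op_add (R : realType) (V W : hilbertType R) (f : V -> W)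
    (T : V -> set W) : V -> set W :=
  fun x => [set f x + y | y in T x].

Definition resolvent (R : realType) (V : hilbertType R) (T : V -> set V) :
    V -> set V :=
  op_inv (op_add idfun T).

Definition gen_resolvent (R : realType) (V W : hilbertType R) (U : V -> W)
    (T : V -> set V) : V -> set V :=
  op_inv (op_add (adjoint U \o U) T).

Definition dual_op (R : realType) (V W : hilbertType R) (H : V -> set V)
    (M : V -> W) (d : W) : W -> set W :=
  fun lambda => [set - M x - d | x in op_inv H (- adjoint M lambda)].

(* Main.v *)
Require Import Defs.
From HB Require Import structures.
From mathcomp Require Import all_boot all_order all_algebra.
From mathcomp Require Import boolp classical_sets reals topology normedtype.
From mathcomp Require Import interval_inference sequences ring lra.

Set Implicit Arguments.
Unset Strict Implicit.
Unset Printing Implicit Defensive.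

Import Order.TTheory GRing.Theory Num.Theory.
Import numFieldNormedType.Exports.

Local Open Scope classical_set_scope.
Local Open Scope ring_scope.

(** Unfolding the resolvents, [lambda] is in [resolvent (gamma D_H) u] iff
    [lambda = u + gamma d + gamma M q] for some [q] with [- M^* lambda] in
    [H q].  Applying [- M^*] to that equation and dividing by [gamma] turns
    the membership into
    [- M^* (u / gamma + d) - M^* M q] in [gamma^-1 H q],
    which is the inclusion defining the generalized resolvent.  Both halves of
    the theorem are read off this equivalence, [mem_resolvent_dual] and
    [mem_gen_resolvent].

    Applying [- M^*] to a sum requires [M^*] to be linear.  As [adjoint] picks
    a vector that satisfies the adjoint identity, linearity in turn requires
    such a vector to exist, which is the Riesz representation theorem
    ([riesz_representation]): the energy [|x|^2 - 2 f x] of a bounded linear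
    form [f] is bounded below, its minimizing sequences are Cauchy by the
    parallelogram identity, and at a minimizer [z] the first variation
    vanishes, that is, [f] is the inner product with [z]. *)

(** * Inner products *)

Section Inner.
Variables (R : realType) (V : hilbertType R).
Implicit Types (x y z : V) (a : R).

Lemma innerDr x y z : inner x (y + z) = inner x y + inner x z.
Proof. by rewrite innerC innerDl !(innerC _ x). Qed.

Lemma innerZr a x y : inner x (a *: y) = a * inner x y.
Proof. by rewrite innerC innerZl innerC. Qed.

Lemma innerNr x y : inner x (- y) = - inner x y.
Proof. by rewrite -scaleN1r innerZr mulN1r. Qed.

Lemma normDZ_sqr a x y :
  `|x + a *: y| ^+ 2 = `|x| ^+ 2 + 2 * a * inner x y + a ^+ 2 * `|y| ^+ 2.
Proof.
rewrite -!inner_norm innerDl !innerDr !innerZl !innerZr (innerC y x); ring.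
Qed.

Lemma inner_injr x y : (forall z, inner z x = inner z y) -> x = y.
Proof.
move=> xy; apply/eqP; rewrite -subr_eq0 -normr_eq0 -sqrf_eq0 -inner_norm.
by rewrite innerDr innerNr xy subrr.
Qed.

End Inner.

(** The discriminant criterion, as used both for the Cauchy-Schwarz inequality
    and, with [c = 0], for the vanishing of a first variation. *)
Lemma discriminant_le0 (R : realFieldType) (a b c : R) : 0 <= a ->
  (forall t, 0 <= a * t ^+ 2 + 2 * b * t + c) -> b ^+ 2 <= a * c.
Proof.
rewrite le_eqVlt => /predU1P[<- pos|a0 pos].
  (* The form is affine: at this [t] it equals [-1] unless [b = 0]. *)
  have [->|b0] := eqVneq b 0; first by rewrite expr0n mul0r.
  have := pos (- (c + 1) / (2 * b)).
  have -> : 0 * (- (c + 1) / (2 * b)) ^+ 2 + 2 * b * (- (c + 1) / (2 * b)) + c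
            = -1 by field.
  lra.
(* The minimum of the form is attained at [- b / a]. *)
have := pos (- b / a).
have -> : a * (- b / a) ^+ 2 + 2 * b * (- b / a) + c = (a * c - b ^+ 2) / a.
  by field; rewrite gt_eqF.
by rewrite pmulr_lge0 ?invr_gt0// subr_ge0.
Qed.

Lemma cauchy_schwarz (R : realType) (V : hilbertType R) (x y : V) :
  `|inner x y| <= `|x| * `|y|.
Proof.
rewrite -(@ler_pXn2r _ 2)// ?nnegrE ?mulr_ge0//.
rewrite real_normK ?num_real// exprMn mulrC.
apply: discriminant_le0 => [|t]; first exact: sqr_ge0.
have := sqr_ge0 `|x + t *: y|; rewrite normDZ_sqr; nra.
Qed.

(** * The Riesz representation theorem *)

Section Riesz.
Variables (R : realType) (V : hilbertType R) (f : {scalar V}) (C : R).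
Hypothesis f_bounded : forall x, `|f x| <= C * `|x|.

(* Completing the square: if [f] is [inner^~ z], this is
   [|x - z|^2 - |z|^2], so minimizing it locates [z]. *)
Let energy x := `|x| ^+ 2 - 2 * f x.

Let energy_ge x : - C ^+ 2 <= energy x.
Proof.
have := f_bounded x; rewrite /energy ler_norml => /andP[_ fx].
have := sqr_ge0 (`|x| - C); nra.
Qed.

Let energyDZ t x y :
  energy (x + t *: y) =
  `|y| ^+ 2 * t ^+ 2 + 2 * (inner x y - f y) * t + energy x.
Proof.
by rewrite /energy normDZ_sqr (linearD f) [f (t *: y)]linearZ /=; ring.
Qed.

(** The parallelogram identity; the linear terms of the energies cancel.  It
    bounds the distance between two points whose energies are nearly minimal,
    since the energy at their midpoint is not below the infimum. *)
Let energy_midpoint x y :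
  `|x - y| ^+ 2 = 2 * (energy x + energy y - 2 * energy (2^-1 *: (x + y))).
Proof.
rewrite /energy [f (_ *: _)]linearZ (linearD f) /= -scaleN1r normDZ_sqr.
rewrite normrZ exprMn ger0_norm ?invr_ge0//.
have -> : `|x + y| ^+ 2 = `|x| ^+ 2 + 2 * inner x y + `|y| ^+ 2.
  by rewrite -[in LHS](scale1r y) normDZ_sqr; ring.
by field.
Qed.

Let energy_set := [set energy x | x in [set: V]].

Let m := inf energy_set.

Let energy_lb : has_lbound energy_set.
Proof. by exists (- C ^+ 2) => _ [x _ <-]; exact: energy_ge. Qed.

Let m_le x : m <= energy x.
Proof. by apply: ge_inf => //; exists x. Qed.

Let f_continuous : continuous (f : V -> R).
Proof.
move=> x; apply/cvgrPdist_le => e e0.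
have C0 : 0 < `|C| + 1 by rewrite ltr_wpDl.
near=> y; rewrite -linearB; apply: le_trans (f_bounded _) _.
apply: (@le_trans _ _ ((`|C| + 1) * `|x - y|)).
  by rewrite ler_wpM2r// (le_trans (ler_norm C))// lerDl.
rewrite mulrC -ler_pdivlMr//; near: y.
by apply: cvgr_dist_le => //; exact: divr_gt0.
Unshelve. all: by end_near. Qed.

Let energy_min : exists z, energy z <= m.
Proof.
have E0 : has_inf energy_set by split => //; exists (energy 0), 0.
have /choice[u u_lt] n : exists x, energy x < m + n.+1%:R^-1.
  have [|_ [x _ <-] ?] := @inf_adherent _ energy_set n.+1%:R^-1 _ E0.
    by rewrite invr_gt0.
  by exists x.
have u_cauchy : cauchy (u @ \oo).
  apply: cauchy_exP => e e0.
  have e4 : 0 < e ^+ 2 / 4 by rewrite divr_gt0// exprn_gt0.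
  have [N _ /(_ N (leqnn N)) N_lt] := near_infty_natSinv_lt (PosNum e4).
  exists (u N); exists N => // n /= Nn; rewrite -ball_normE /ball_/=.
  rewrite -(@ltr_pXn2r _ 2)// ?nnegrE ?(ltW e0)// energy_midpoint.
  have nN : n.+1%:R^-1 <= N.+1%:R^-1 :> R by rewrite lef_pV2 ?posrE// ler_nat.
  have {N_lt} : N.+1%:R^-1 < e ^+ 2 / 4 := N_lt.
  have := m_le (2^-1 *: (u N + u n)); move: (u_lt n) (u_lt N) nN.
  move: (energy _) (energy _) (energy _) (_^-1) (_^-1) => a b c i j; lra.
have /cauchy_cvgP/cvg_ex[z u_z] := u_cauchy.
exists z; apply: (@ler_cvg_to _ \oo _ _ (energy \o u)
                    (fun n => m + n.+1%:R^-1)); last first.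
- by near=> n; exact/ltW/u_lt.
- rewrite -[X in _ --> X]addr0; apply: cvgD; first exact: cvg_cst.
  exact: cvg_harmonic.
- apply: cvgB; last first.
    apply: cvgM; first exact: cvg_cst.
    exact: (continuous_cvg _ (@f_continuous z) u_z).
  by rewrite expr2; apply: cvgM; apply: cvg_norm.
Unshelve. all: by end_near. Qed.

Lemma riesz_representation : exists z, forall x, f x = inner x z.
Proof.
have [z z_min] := energy_min; exists z => x.
(* Along the line through [z] in direction [x] the energy is minimal at [z],
   so its linear coefficient there is zero. *)
suff : (inner z x - f x) ^+ 2 <= `|x| ^+ 2 * 0.
  rewrite mulr0 real_exprn_even_le0 ?num_real//= subr_eq0 => /eqP <-.
  exact: innerC.
apply: discriminant_le0 => [|t]; first exact: sqr_ge0.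
by have := m_le (z + t *: x); rewrite energyDZ; lra.
Qed.

End Riesz.

(** * The adjoint of a bounded linear map *)

Section Adjoint.
Variables (R : realType) (V W : hilbertType R) (M : {linear V -> W}).
Hypothesis M_bounded : exists r : R, forall x, `|M x| <= r * `|x|.

Lemma adjointP y x : inner (M x) y = inner x (adjoint M y).
Proof.
have [r Mr] := M_bounded.
pose f x' : R := inner (M x') y.
have f_lin : scalar f by move=> a u v; rewrite /f linearP innerDl innerZl.
pose fL : {scalar V} := HB.pack f (GRing.isLinear.Build R V R *%R f f_lin).
have fC x' : `|fL x'| <= r * `|y| * `|x'|.
  by rewrite (le_trans (cauchy_schwarz _ _))// mulrAC ler_wpM2r.
exact: (xgetPex 0 (riesz_representation fC)).
Qed.

Lemma adjointD x y : adjoint M (x + y) = adjoint M x + adjoint M y.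
Proof. by apply: inner_injr => z; rewrite innerDr -!adjointP innerDr. Qed.

Lemma adjointZ a x : adjoint M (a *: x) = a *: adjoint M x.
Proof. by apply: inner_injr => z; rewrite innerZr -!adjointP innerZr. Qed.

End Adjoint.

(** * Resolvents of the dual operator *)

Section Dual.
Variables (R : realType) (V W : hilbertType R) (H : V -> set V).
Variables (M : {linear V -> W}) (d : W) (gamma : R).

Lemma mem_resolvent_dual u lambda :
  resolvent (op_scale gamma (dual_op H M d)) u lambda <->
  exists2 q, H q (- adjoint M lambda) & lambda = u + gamma *: d + gamma *: M q.
Proof.
have solve q : lambda + gamma *: (- M q - d) = u <->
    lambda = u + gamma *: d + gamma *: M q.
  rewrite -opprD scalerN scalerDr -addrA [gamma *: d + _]addrC.
  by split=> [<-|->]; rewrite ?subrK ?addrK.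
split=> [[_ [_ [q Hq <-] <-] /solve lE]|[q Hq /solve lE]]; first by exists q.
exists (gamma *: (- M q - d)) => //.
by exists (- M q - d) => //; exists q.
Qed.

Hypothesis M_bounded : exists r : R, forall x : V, `|M x| <= r * `|x|.
Hypothesis gamma_neq0 : gamma != 0.

(** The right-hand side is the condition of [mem_resolvent_dual] with [lambda]
    replaced by its value, so the two resolvents are governed by the same
    points [q]. *)
Lemma mem_gen_resolvent u q :
  gen_resolvent M (op_scale gamma^-1 H)
    (- adjoint M (gamma^-1 *: u + d)) q <->
  H q (- adjoint M (u + gamma *: d + gamma *: M q)).
Proof.
have solve h : adjoint M (M q) + gamma^-1 *: h =
      - adjoint M (gamma^-1 *: u + d) <->
    h = - adjoint M (u + gamma *: d + gamma *: M q).
  have -> : u + gamma *: d + gamma *: M q =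
      gamma *: (gamma^-1 *: u + d + M q).
    by rewrite !scalerDr scalerA divff// scale1r.
  rewrite adjointZ// (adjointD M_bounded (_ + d)) -scalerN opprD.
  split=> [<-|->]; last by rewrite scalerA mulVf// scale1r addrCA subrr addr0.
  by rewrite [adjoint M (M q) + _]addrC addrK scalerA divff// scale1r.
split=> [[_ [h Hh <-] /solve <-] //|Hq].
by exists (gamma^-1 *: - adjoint M (u + gamma *: d + gamma *: M q));
  [exists (- adjoint M (u + gamma *: d + gamma *: M q)) | apply/solve].
Qed.

End Dual.

Theorem theorem4 (R : realType) (V W : hilbertType R) (H : V -> set V)
    (M : {linear V -> W})
    (M_bounded : exists r : R, forall x : V, `|M x| <= r * `|x|)
    (d : W) (gamma : R) (gamma_gt0 : 0 < gamma) :
  (forall u : W,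
     resolvent (op_scale gamma (dual_op H M d)) u =
     [set u + gamma *: d + gamma *: M q
       | q in gen_resolvent M (op_scale gamma^-1 H)
                (- adjoint M (gamma^-1 *: u + d))]) /\
  (forall u lambda : W,
     resolvent (op_scale gamma (dual_op H M d)) u lambda ->
     exists (p : W) (q : V),
       [/\ dual_op H M d lambda p /\ u = gamma *: p + lambda,
           op_inv H (- adjoint M lambda) q /\ p = - M q - d
         & gen_resolvent M (op_scale gamma^-1 H)
             (- adjoint M (gamma^-1 *: u + d)) q]).
Proof.
have gamma_neq0 : gamma != 0 by rewrite gt_eqF.
split=> [u|u lambda].
  apply/seteqP; split=> lambda.
    move=> /mem_resolvent_dual[q Hq lE]; exists q => //.
    by apply/mem_gen_resolvent => //; rewrite -lE.
  move=> [q /(mem_gen_resolvent _ _ M_bounded gamma_neq0) Hq lE].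
  by apply/mem_resolvent_dual; exists q; rewrite -lE.
move=> /mem_resolvent_dual[q Hq lE]; exists (- M q - d), q; split.
- split; first by exists q.
  by rewrite lE -opprD scalerN scalerDr -addrA [gamma *: d + _]addrC addrCA
             [- _ + _]addrC subrr addr0.
- by split.
- by apply/mem_gen_resolvent => //; rewrite -lE.
Qed.
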